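(* Suppose that $\mathbb{P}$ is a forcing and $\kappa$ is a cardinal. Then the following statements are equivalent: (1) $\mathsf{FA}_{\mathbb{P},\kappa}$. (2) For every nice $\mathbb{P}$-name $\sigma$ for a subset of $\kappa$ with $\mathbb{P}\Vdash\sigma=\check{\kappa}$, there is a filter $g\in V$ on $\mathbb{P}$ with $\sigma^g=\kappa$. (3) For every nice $\mathbb{P}$-name $\sigma$ for a subset of $\kappa$, there is a single filter $g\in V$ on $\mathbb{P}$ such that for every first-order sentence $\varphi$ in the language of structures of the form $(\kappa,\in,S)$ with $S\subseteq\kappa$ a unary predicate: if $\mathbb{P}\Vdash$ ''$(\check\kappa,\in,\sigma)\models\varphi$'', then $(\kappa,\in,\sigma^g)\models\varphi$ holds in $V$.
   Context: A forcing is a partial order $\mathbb{P}$ with a largest element $1$; $\mathbb{P}\Vdash\varphi$ means $1\Vdash\varphi$. $V$ is the ground model. $\mathsf{FA}_{\mathbb{P},\kappa}$ states: for any sequence $\langle D_\alpha\mid\alpha<\kappa\rangle$ of predense (equivalently, dense) subsets of $\mathbb{P}$ there is a filter $g\in V$ on $\mathbb{P}$ with $g\cap D_\alpha\neq\emptyset$ for all $\alpha<\kappa$. A nice name for a subset of $\kappa$ is a name of the form $\{(\check\alpha,p)\mid \alpha<\kappa,\ p\in A_\alpha\}$, where each $A_\alpha$ is an antichain of $\mathbb{P}$. For a filter $g$ (not assumed generic), $\sigma^g=\{\tau^g\mid \exists p\in g\ (\tau,p)\in\sigma\}$ is the recursive evaluation of $\sigma$. *)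

(* Defs.v *)
From mathcomp Require Import all_boot all_order.
From mathcomp Require Import boolp classical_sets functions cardinality.
Set Implicit Arguments.
Unset Strict Implicit.
Unset Printing Implicit Defensive.
Import Order.TTheory.

Local Open Scope classical_set_scope.
Local Open Scope order_scope.

(* The sets of the ground model, as well-founded trees: [VSet x] is the set
   {x i | i : X}. Equality of sets is the extensional [veq], not [=]. *)
Inductive vset : Type := VSet (X : Type) (x : X -> vset).

Fixpoint veq (a b : vset) : Prop :=
  match a, b with
  | VSet X x, VSet Y y =>
      (forall i, exists j, veq (x i) (y j)) /\
      (forall j, exists i, veq (x i) (y j))
  end.

Definition vmem (a b : vset) : Prop :=
  match b with VSet Y y => exists j, veq a (y j) end.

(* A cardinal is an initial ordinal: a well-ordered type that is not
   equinumerous with any of its proper initial segments. Finite cardinals,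
   including 0, are allowed. *)
Record cardinal := Cardinal {
  card_disp : Order.disp_t;
  card_sort :> orderType card_disp;
  card_wf : well_founded (fun a b : card_sort => a < b);
  card_initial :
    forall a : card_sort, ~ ([set: card_sort] #= [set b | b < a])%card
}.

(* The von Neumann ordinal {vN b | b < a} of an element a of kappa, and that
   of kappa itself. *)
Definition vN (kappa : cardinal) : kappa -> vset :=
  Fix (@card_wf kappa) (fun _ => vset)
    (fun a rec =>
       VSet (fun b : {b : kappa | b < a} => rec (sval b) (svalP b))).

Definition vN_card (kappa : cardinal) : vset := VSet (@vN kappa).

Section Forcing.
Context {d : Order.disp_t} {P : tPOrderType d}.

Definition compatible (p q : P) : Prop := exists r : P, r <= p /\ r <= q.

Definition predense (D : set P) : Prop :=
  forall p, exists2 q, D q & compatible p q.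

Definition antichain (A : set P) : Prop :=
  forall p q, A p -> A q -> p <> q -> ~ compatible p q.

Definition is_filter (g : set P) : Prop :=
  [/\ g !=set0,
      forall p q, g p -> p <= q -> g q
    & forall p q, g p -> g q -> exists2 r, g r & r <= p /\ r <= q].

(* [Name t c] is the name {(t i, c i) | i : T}. *)
Inductive name : Type := Name (T : Type) (t : T -> name) (c : T -> P).

Fixpoint check (a : vset) : name :=
  match a with VSet X x => Name (fun i => check (x i)) (fun=> \top) end.

Fixpoint eval (g : set P) (s : name) : vset :=
  match s with
  | Name T t c => VSet (fun i : {i : T | g (c i)} => eval g (t (sval i)))
  end.

Definition nice_name_of (kappa : cardinal) (A : kappa -> set P) : name :=
  Name (fun x : {x : kappa * P | A x.1 x.2} => check (vN (sval x).1))
         (fun x => (sval x).2).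

Definition nice_name (kappa : cardinal) (s : name) : Prop :=
  exists2 A : kappa -> set P,
    (forall a, antichain (A a)) & s = nice_name_of A.

Definition dense_below (p : P) (D : set P) : Prop :=
  forall q, q <= p -> exists2 r, r <= q & D r.

(* The forcing relation for atomic formulas is the usual recursion on names,
   carried out in the ground model. *)
Fixpoint forces_eq (s t : name) (p : P) : Prop :=
  match s, t with
  | Name T s' c, Name U t' e =>
      (forall i, dense_below p (fun q => q <= c i ->
         exists2 j, q <= e j & forces_eq (s' i) (t' j) q)) /\
      (forall j, dense_below p (fun q => q <= e j ->
         exists2 i, q <= c i & forces_eq (s' i) (t' j) q))
  end.

Definition forces_mem (s t : name) (p : P) : Prop :=
  match t with
  | Name U t' e =>
      dense_below p (fun q => exists2 j, q <= e j & forces_eq s (t' j) q)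
  end.

End Forcing.

Arguments name {d} P.

(* FA_{P,kappa} *)
Definition FA (d : Order.disp_t) (P : tPOrderType d) (kappa : cardinal) : Prop :=
  forall D : kappa -> set P, (forall a, predense (D a)) ->
  exists2 g : set P, is_filter g & forall a, g `&` D a !=set0.

(* Valuations of n.+1 variables; a quantifier binds variable [ord0]. *)
Definition push (T : Type) n (x : T) (v : 'I_n -> T) (i : 'I_n.+1) : T :=
  if unlift ord0 i is Some j then v j else x.

Definition novars (T : Type) (i : 'I_0) : T :=
  match notF (eq_trans (esym (ltn0 i)) (ltn_ord i)) with end.

(* First-order formulas with n free variables in the language of structures
   (M, E, S), with E binary and S unary. *)
Inductive formula : nat -> Type :=
| FEq n (i j : 'I_n) : formula n
| FMem n (i j : 'I_n) : formula n
| FPred n (i : 'I_n) : formula n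
| FNot n (f : formula n) : formula n
| FAnd n (f h : formula n) : formula n
| FAll n (f : formula n.+1) : formula n.

Definition sentence := formula 0.

Fixpoint sat (M : Type) (E : M -> M -> Prop) (S : M -> Prop) n
    (f : formula n) : ('I_n -> M) -> Prop :=
  match f in formula n return ('I_n -> M) -> Prop with
  | FEq _ i j => fun v => v i = v j
  | FMem _ i j => fun v => E (v i) (v j)
  | FPred _ i => fun v => S (v i)
  | FNot _ f => fun v => ~ sat E S f v
  | FAnd _ f h => fun v => sat E S f v /\ sat E S h v
  | FAll _ f => fun v => forall x, sat E S f (push x v)
  end.

(* The satisfaction (kappa, \in, a) |= f in the ground model; the elements of
   kappa are represented by the type kappa, via [vN]. *)
Definition models (kappa : cardinal) (a : vset) (f : sentence) : Prop :=
  sat (fun x y : kappa => vmem (vN x) (vN y)) (fun x : kappa => vmem (vN x) a)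
      f (@novars kappa).

(* The forcing language: formulas of set theory with n free variables and
   constants from C (below, the names). *)
Inductive set_formula (C : Type) : nat -> Type :=
| SEq n (x y : 'I_n + C) : set_formula C n
| SMem n (x y : 'I_n + C) : set_formula C n
| SNot n (f : set_formula C n) : set_formula C n
| SAnd n (f h : set_formula C n) : set_formula C n
| SAll n (f : set_formula C n.+1) : set_formula C n.

Definition SImp C n (f h : set_formula C n) : set_formula C n :=
  SNot (SAnd f (SNot h)).

Definition term_val C n (v : 'I_n -> C) (x : 'I_n + C) : C :=
  match x with inl i => v i | inr c => c end.

(* [forces f v p] is p ||- f(v). *)
Fixpoint forces (d : Order.disp_t) (P : tPOrderType d) n
    (f : set_formula (name P) n) : ('I_n -> name P) -> P -> Prop :=
  match f in set_formula _ n return ('I_n -> name P) -> P -> Prop with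
  | SEq _ x y => fun v p => forces_eq (term_val v x) (term_val v y) p
  | SMem _ x y => fun v p => forces_mem (term_val v x) (term_val v y) p
  | SNot _ f => fun v p => forall q, q <= p -> ~ forces f v q
  | SAnd _ f h => fun v p => forces f v p /\ forces h v p
  | SAll _ f => fun v p => forall t, forces f (push t v) p
  end.

(* P ||- f *)
Definition forced (d : Order.disp_t) (P : tPOrderType d)
    (f : set_formula (name P) 0) : Prop :=
  forces f (@novars (name P)) \top.

(* The formula of set theory "(K, \in, S) |= f": the quantifiers of f are
   bounded by K and its unary predicate is membership in S. *)
Fixpoint satisfies C (K S : C) n (f : formula n) : set_formula C n :=
  match f in formula n return set_formula C n with
  | FEq _ i j => SEq (inl i) (inl j)
  | FMem _ i j => SMem (inl i) (inl j)
  | FPred _ i => SMem (inl i) (inr S)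
  | FNot _ f => SNot (satisfies K S f)
  | FAnd _ f h => SAnd (satisfies K S f) (satisfies K S h)
  | FAll _ f => SAll (SImp (SMem (inl ord0) (inr K)) (satisfies K S f))
  end.

(* Main.v *)
Require Import Defs.
From HB Require Import structures.
From mathcomp Require Import all_boot all_order.
From mathcomp Require Import boolp classical_sets functions cardinality.
From Stdlib Require Import Relation_Operators Wellfounded.
Set Implicit Arguments.
Unset Strict Implicit.
Unset Printing Implicit Defensive.
Import Order.TTheory.

(** That [clause2] implies [clause1] and [clause3] implies [clause2] is a matter
of translation. Below a predense set [D a] there is a maximal antichain [A a],
which is again predense ([predense_refining_antichain]); the nice name with antichains [A a] is then
forced to equal [kappa], and a filter evaluates it to [kappa] exactly when it
meets every [A a] ([eval_nice_full]), hence every [D a]. And [sigma = kappa] is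
expressed by the sentence saying that the predicate holds of everything.

To derive [clause3] from [clause1], the forcing relation for sentences about
[(kappa, \in, sigma)] reduces to a relation [sforces] in which variables
stand for elements of [kappa] ([forces_satisfies]): a name forced into [kappa] is
locally forced equal to a check name. For this relation a truth lemma holds for filters of the ground
model, provided the filter decides the predicate and provides witnesses for
failing universal formulas ([truth_lemma]). If [kappa] is infinite, this asks the
filter to meet one dense set for each formula and each tuple of parameters from
[kappa] ([generic_truth]); there are at most [kappa] of these
([infinite_instances_injective], which rests on [kappa * kappa <= kappa],
[card_square_le]), so the forcing axiom yields such a filter, and it serves all
sentences at once. If [kappa] is finite the formulas outnumber [kappa], but some
condition already decides the entire predicate, and the principal filter above
it works outright ([finite_truth]). *)

Local Open Scope classical_set_scope.
Local Open Scope order_scope.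

(** * The square of an infinite cardinal *)

Lemma embedding_card_le (T U : Type) (A : set T) (B : set U) (f : T -> U) :
  (forall x, A x -> B (f x)) ->
  (forall x y, A x -> A y -> f x = f y -> x = y) -> (A #<= B)%card.
Proof.
move=> fB finj; apply: (card_le_trans _ (subset_card_le (_ : f @` A `<=` B))).
  rewrite (card_le_eqr (inj_card_eq _)) // => x y /set_mem Ax /set_mem Ay.
  exact: finj.
by move=> _ [x /fB Bfx <-].
Qed.

Lemma card_le_embedding (T : Type) (U : choiceType) (u0 : U)
    (A : set T) (B : set U) :
  (A #<= B)%card ->
  exists2 f : T -> U, forall x, A x -> B (f x)
    & forall x y, A x -> A y -> f x = f y -> x = y.
Proof.
pose U' : pointedType := HB.pack U (isPointed.Build U u0).
move=> /(@pcard_leP T U') [f]; exists f; first by move=> x Ax; exact: funS.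
by move=> x y Ax Ay; apply: (@inj _ _ A f); rewrite inE.
Qed.

Lemma card_le_square (T U : choiceType) (A : set T) (B : set U) :
  (A #<= B)%card -> (A `*` A #<= B `*` B)%card.
Proof.
move=> AB; have [->|/set0P [a Aa]] := eqVneq A set0; first by rewrite setX0 card_ge0.
have [b0 _] : B !=set0.
  by apply/set0P/eqP => B0; move: AB; rewrite B0 => /card_le0P A0; rewrite A0 in Aa.
have [f fB finj] := card_le_embedding b0 AB.
apply: (@embedding_card_le _ _ _ _ (fun x => (f x.1, f x.2))) => [[x y] [] /= /fB ? /fB ? //|].
by move=> [x y] [x' y'] [/= ? ?] [/= ? ?] [/finj -> // /finj ->].
Qed.

(** Hilbert's hotel: shift a copy of [nat] inside [A] to make room for [a]. *)
Lemma infinite_setU1 (T : choiceType) (A : set T) (a : T) :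
  infinite_set A -> (a |` A #<= A)%card.
Proof.
move=> /infiniteP /(card_le_embedding a) [e eA einj].
have {}einj m n : e m = e n -> m = n by apply: einj.
have ran x : {n | e n = x} + {forall n, e n <> x}.
  by case: (pselect (exists n, e n = x)) => [/cid|/forallNP]; [left|right].
have [Aa|nAa] := pselect (A a); first by apply: subset_card_le => y [->|].
pose f x := if `[< x = a >] then e 0%N else if ran x is inleft n then e (sval n).+1 else x.
apply: (@embedding_card_le _ _ _ _ f).
  move=> x; rewrite /f; case: asboolP => [_ _|xa [//|Ax]]; first exact: eA.
  by case: (ran x) => [[n ?]|?] //; exact: eA.
move=> x y Ax Ay; rewrite /f; case: asboolP => [->|xa]; case: asboolP => [->|ya] //.
- by case: (ran y) => [[n ?] /= /einj|/[apply]].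
- by case: (ran x) => [[n ?] /= /einj|nx /esym /nx].
- case: (ran x) => [[n nx]|nx]; case: (ran y) => [[m my]|my] //=.
  + by move=> /einj [nm]; rewrite -nx -my nm.
  + by move=> /my.
  + by move=> /esym /nx.
Qed.

(** Transfinite recursion sends each point of [A] to an element of [B] not yet
used; such an element exists because the values used so far are the image of a
predecessor set too small to exhaust [B]. *)
Lemma greedy_embedding (S : Type) (T : choiceType) (R : S -> S -> Prop)
    (A : set S) (B : set T) :
  well_founded R -> (forall x y, R x y \/ x = y \/ R y x) ->
  (forall x, A x -> ~ (B #<= [set y | A y /\ R y x])%card) ->
  (A #<= B)%card.
Proof.
move=> Rwf Rtot small.
have [B0|/set0P [b0 _]] := eqVneq B set0.
  suff -> : A = set0 by exact: card_ge0.
  by rewrite -subset0 => x /small; apply; rewrite B0 card_ge0.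
pose fresh x (f : forall y, R y x -> T) : set T :=
  [set b | B b /\ forall y (Ryx : R y x), A y -> f y Ryx <> b].
pose f := Fix Rwf (fun=> T) (fun x f => xget b0 (fresh x f)).
have fE x : f x = xget b0 (fresh x (fun y _ => f y)).
  rewrite /f Fix_eq // => {}x g h gh; congr xget.
  by apply/seteqP; split=> b [Bb gb]; split=> // y Ryx; [rewrite -gh|rewrite gh]; exact: gb.
have fP x : A x -> fresh x (fun y _ => f y) (f x).
  move=> Ax; rewrite fE; apply: xgetPex; apply: contrapT => /forallNP nofresh.
  apply: (small x Ax); apply: (card_le_trans _ (card_image_le f _)).
  apply: subset_card_le => b Bb; apply: contrapT => nb.
  apply: (nofresh b); split=> // y Ryx Ay fy.
  by apply: nb; exists y.
apply: (@embedding_card_le _ _ _ _ f) => [x /fP []//|x y Ax Ay fxy].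
have [_ freshx] := fP x Ax; have [_ freshy] := fP y Ay.
have [Rxy|[//|Ryx]] := Rtot x y; first by case: (freshy _ Rxy Ax).
by case: (freshx _ Ryx Ay).
Qed.

Section Hessenberg.
Context {d : Order.disp_t} {T : orderType d}.
Hypothesis wf : well_founded (fun a b : T => a < b).

Let seg (a : T) : set T := [set b | b <= a].

(** Goedel's well-order of pairs: by maximum, then lexicographically, so that
the predecessors of a pair lie in a square box bounded by its maximum. *)
Let godel (x y : T * T) : Prop :=
  slexprod T (T * T) (fun a b => a < b)
    (slexprod T T (fun a b => a < b) (fun a b => a < b))
    (Order.max x.1 x.2, x) (Order.max y.1 y.2, y).

Let godel_wf : well_founded godel.
Proof.
exact: (wf_inverse_image _ _ _ (fun x : T * T => (Order.max x.1 x.2, x))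
  (wf_slexprod _ _ _ _ wf (wf_slexprod _ _ _ _ wf wf))).
Qed.

Let godel_total (x y : T * T) : godel x y \/ x = y \/ godel y x.
Proof.
rewrite /godel; have [lt|lt|->] := ltgtP (Order.max x.1 x.2) (Order.max y.1 y.2).
- by left; left.
- by right; right; left.
case: x y => [x1 x2] [y1 y2] /=.
have [lt|lt|->] := ltgtP x1 y1.
- by left; right; left.
- by right; right; right; left.
have [lt|lt|->] := ltgtP x2 y2; last by right; left.
- by left; right; right.
- by right; right; right; right.
Qed.

Let godel_max x y : godel x y -> Order.max x.1 x.2 <= Order.max y.1 y.2.
Proof. by move=> G; inversion G; [exact: ltW|]. Qed.

Let square_card_le (B : set T) :
  (forall a, B a -> ~ (B #<= seg a `*` seg a)%card) -> (B `*` B #<= B)%card.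
Proof.
move=> small; apply: (greedy_embedding godel_wf godel_total) => -[x1 x2] [/= Bx1 Bx2] le.
have Bm : B (Order.max x1 x2) by case: leP.
apply: (small _ Bm); apply: card_le_trans le _.
apply: subset_card_le => y [_ /godel_max /=]; rewrite ge_max => /andP[y1 y2].
by split.
Qed.

Let seg_strict a : infinite_set (seg a) ->
  infinite_set [set b | b < a] /\ (seg a #<= [set b | (b < a)%O])%card.
Proof.
have -> : seg a = a |` [set b | b < a].
  apply/seteqP; split=> b; rewrite /= /seg /= le_eqVlt.
    by case/predU1P; [left|right].
  by case=> [->|->]; rewrite ?eqxx ?orbT.
move=> inf_a; have inf_lt : infinite_set [set b | b < a].
  by apply: contra_not inf_a => fin; rewrite finite_setU.
by split=> //; exact: infinite_setU1.
Qed.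

(** By induction on [a]. If [seg a] embeds into a smaller segment, the
induction hypothesis applies there; otherwise [a] behaves like an infinite
cardinal, and a box below it is either finite or, by induction, no larger than
its side. *)
Let seg_square a : infinite_set (seg a) -> (seg a `*` seg a #<= seg a)%card.
Proof.
elim/(well_founded_ind wf): a => a IH inf_a.
have [[b ba ab]|noinj] := pselect (exists2 b, b < a & (seg a #<= seg b)%card).
  have inf_b : infinite_set (seg b) by apply: contra_not inf_a; exact: card_le_finite.
  apply: card_le_trans (card_le_square ab) _; apply: card_le_trans (IH _ ba inf_b) _.
  by apply: subset_card_le => c /le_trans; apply; exact: ltW.
(* The bounds in [square_card_le] must lie strictly below [a], so [seg a] is
   first traded for the strict segment. *)
have [inf_lt aB] := seg_strict inf_a.
apply: card_le_trans (card_le_square aB) _.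
apply: card_le_trans (square_card_le _) _; last by apply: subset_card_le => b /ltW.
move=> c ca Bc; apply: noinj; exists c => //.
have inf_c : infinite_set (seg c).
  by apply: contra_not inf_lt => fc; apply: card_le_finite Bc _; exact: finite_setX.
by apply: card_le_trans aB _; apply: card_le_trans Bc _; exact: IH.
Qed.

(** Hessenberg's theorem for initial ordinals: no box below [a] can be
equinumerous with the whole type, since it would have the size of a proper
initial segment. *)
Lemma card_square_le :
  (forall a : T, ~ ([set: T] #= [set b | (b < a)%O])%card) ->
  infinite_set [set: T] -> ([set: T * T] #<= [set: T])%card.
Proof.
move=> initial inf; rewrite -setXTT; apply: square_card_le => a _ le.
have inf_a : infinite_set (seg a).
  by apply: contra_not inf => fa; apply: card_le_finite le _; exact: finite_setX.
have {}le := card_le_trans le (seg_square inf_a).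
apply: (initial a); apply/card_eqPle; split; last exact: card_leT.
exact: card_le_trans le (seg_strict inf_a).2.
Qed.

End Hessenberg.

(** * Counting the instances of formulas *)

(** An injective code, to borrow the countability of [GenTree.tree nat]. *)
Fixpoint formula_tree n (f : formula n) : GenTree.tree nat :=
  match f with
  | FEq _ i j => GenTree.Node 0 [:: GenTree.Leaf (val i); GenTree.Leaf (val j)]
  | FMem _ i j => GenTree.Node 1 [:: GenTree.Leaf (val i); GenTree.Leaf (val j)]
  | FPred _ i => GenTree.Node 2 [:: GenTree.Leaf (val i)]
  | FNot _ f => GenTree.Node 3 [:: formula_tree f]
  | FAnd _ f h => GenTree.Node 4 [:: formula_tree f; formula_tree h]
  | FAll _ f => GenTree.Node 5 [:: formula_tree f]
  end.

Lemma formula_tree_inj n : injective (@formula_tree n).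
Proof.
elim=> {n} [n i j|n i j|n i|n f IHf|n f IHf h IHh|n f IHf] k.
- by case: n / k i j => //= n i' j' i j [/val_inj -> /val_inj ->].
- by case: n / k i j => //= n i' j' i j [/val_inj -> /val_inj ->].
- by case: n / k i => //= n i' i [/val_inj ->].
- by case: n / k f IHf => //= n f' f IHf [/IHf ->].
- by case: n / k f IHf h IHh => //= n f' h' f IHf h IHh [/IHf -> /IHh ->].
- by case: n / k f IHf => //= n f' f IHf [/IHf ->].
Qed.

Definition formula_instance (T : Type) := {n & (formula n * ('I_n -> T))%type}.

(** There are countably many formulas and, as [kappa * kappa <= kappa],
no more than [kappa] finite sequences of elements of [kappa]. *)
Lemma infinite_instances_injective (kappa : cardinal) :
  infinite_set [set: kappa] -> exists c : formula_instance kappa -> kappa, injective c.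
Proof.
move=> inf; have [a0 _] := infinite_setN0 inf.
have [p _ pinj] := card_le_embedding a0
  (card_square_le (@card_wf kappa) (@card_initial kappa) inf).
have {}pinj x y : p x = p y -> x = y by apply: pinj.
have /infiniteP/(card_le_embedding a0) [e _ einj] := inf.
have {}einj m n : e m = e n -> m = n by apply: einj.
(* The tags [e 0] and [e 1] keep the empty sequence apart from the others, so
   that the length need not be recorded. *)
pose code := foldr (fun x y => p (e 1%N, p (x, y))) (p (e 0%N, e 0%N)).
have code_inj : injective code.
  elim=> [|x s IHs] [|y t] //=; try by move=> /pinj [] /einj.
  by move=> /pinj [] /pinj [-> /IHs ->].
pose c (k : formula_instance kappa) : kappa :=
  p (e (pickle (tag k, formula_tree (tagged k).1)),
     code [seq (tagged k).2 i | i <- enum 'I_(tag k)]).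
exists c => -[n [f v]] [m [h w]] /pinj [] /einj /(pcan_inj pickleK) [nm].
move: h w; rewrite -{}nm => h w /formula_tree_inj <- /code_inj /eq_in_map vw.
suff -> : v = w by [].
by apply/funext => i; apply: vw; rewrite mem_enum.
Qed.

(** The forcing axiom only sees how many predense sets there are. *)
Lemma FA_injective (d : Order.disp_t) (P : tPOrderType d) (kappa : cardinal)
    (I : Type) (c : I -> kappa) (D : I -> set P) :
  injective c -> FA P kappa -> (forall i, predense (D i)) ->
  exists2 g : set P, is_filter g & forall i, g `&` D i !=set0.
Proof.
move=> cinj fa preD.
have [|g fg gD] := fa (fun a => [set p | forall i, c i = a -> D i p]).
  move=> a p; have [[i cia]|noi] := pselect (exists i, c i = a).
    have [q Diq pq] := preD i p.
    by exists q => // j cja; rewrite (cinj j i) // cja cia.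
  by exists p; [move=> i cia; case: noi; exists i|exists p].
exists g => // i; have [p [gp Dp]] := gD (c i).
by exists p; split=> //; exact: Dp.
Qed.

(** * Names, evaluation and atomic forcing *)

Lemma veq_refl a : veq a a.
Proof. by elim: a => X x IH; split=> i; exists i. Qed.

Lemma veq_sym a b : veq a b -> veq b a.
Proof.
elim: a b => X x IH [Y y] [xy yx]; split=> [j|i].
- by have [i /IH ?] := yx j; exists i.
- by have [j /IH ?] := xy i; exists j.
Qed.

Section VonNeumann.
Context {kappa : cardinal}.

Lemma vNE (a : kappa) :
  vN a = VSet (fun b : {b : kappa | b < a} => vN (sval b)).
Proof.
rewrite /vN Fix_eq // => x f g fg; congr VSet.
by apply/funext => -[b bx]; exact: fg.
Qed.

Lemma vN_inj (a b : kappa) : veq (vN a) (vN b) -> a = b.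
Proof.
elim/(well_founded_ind (@card_wf kappa)): a b => a IH b.
rewrite vNE [vN b]vNE => -[ab ba]; have [lt|lt|//] := ltgtP a b.
- by have [[c ca] /(IH _ ca) /= E] := ba (exist _ a lt); rewrite E ltxx in ca.
- have [[c cb] /= bc] := ab (exist _ b lt).
  by rewrite -(IH _ lt _ bc) ltxx in cb.
Qed.

End VonNeumann.

Section Forcing.
Context {d : Order.disp_t} {P : tPOrderType d}.
Implicit Types (p q r : P) (D : set P) (s t u : name P).

Lemma dense_below_le p q D : q <= p -> dense_below p D -> dense_below q D.
Proof. by move=> qp pD r rq; apply: pD; exact: le_trans rq qp. Qed.

Lemma forces_eq_refl s p : forces_eq s s p.
Proof.
elim: s p => T s IH c p; split=> i q _; exists q => // qc; exists i => //; exact: IH.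
Qed.

Lemma forces_eq_sym s t p : forces_eq s t p -> forces_eq t s p.
Proof.
elim: s t p => T s IH c [U t e] p [st ts]; split=> [j|i] q qp.
- have [r rq rj] := ts j q qp; exists r => // /rj [i ri /IH ?]; by exists i.
- have [r rq ri] := st i q qp; exists r => // /ri [j rj /IH ?]; by exists j.
Qed.

Lemma forces_eq_le s t p q : q <= p -> forces_eq s t p -> forces_eq s t q.
Proof.
by case: s t => [T s c] [U t e] qp [st ts]; split=> i; apply: dense_below_le qp _.
Qed.

Lemma forces_eq_trans t s u p :
  forces_eq s t p -> forces_eq t u p -> forces_eq s u p.
Proof.
elim: s t u p => T s IH c [U t e] [W u h] p [st ts] [tu ut].
split=> [i|k] q qp.
- have [r rq ri] := st i q qp.
  have [rc|/negP nrc] := boolP (r <= c i); last by exists r.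
  have [j rj stj] := ri rc.
  have [r' r'r r'j] := tu j r (le_trans rq qp).
  have [k r'k tuk] := r'j (le_trans r'r rj).
  exists r'; first exact: le_trans r'r rq.
  by move=> _; exists k => //; apply: IH tuk; exact: forces_eq_le stj.
- have [r rq rk] := ut k q qp.
  have [rh|/negP nrh] := boolP (r <= h k); last by exists r.
  have [j rj tuj] := rk rh.
  have [r' r'r r'j] := ts j r (le_trans rq qp).
  have [i r'i sti] := r'j (le_trans r'r rj).
  exists r'; first exact: le_trans r'r rq.
  by move=> _; exists i => //; apply: IH sti _; exact: forces_eq_le tuj.
Qed.

Lemma forces_mem_eql s t u p :
  forces_eq s t p -> forces_mem s u p -> forces_mem t u p.
Proof.
case: u => U u e st su q qp; have [r rq [j rj suj]] := su q qp.
exists r => //; exists j => //; apply: forces_eq_trans suj.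
by apply: forces_eq_le (forces_eq_sym st); exact: le_trans qp.
Qed.

Lemma forces_mem_eqr s t u p :
  forces_eq t u p -> forces_mem s t p -> forces_mem s u p.
Proof.
case: t u => [U t e] [W u h] [tu _] st q qp; have [r rq [j rj stj]] := st q qp.
have [r' r'r r'j] := tu j r (le_trans rq qp).
have [k r'k tuk] := r'j (le_trans r'r rj).
exists r'; first exact: le_trans r'r rq.
by exists k => //; apply: forces_eq_trans tuk; exact: forces_eq_le stj.
Qed.

Lemma forces_eq_check a b p : forces_eq (check a) (check b) p <-> veq a b.
Proof.
elim: a b p => X x IH [Y y] p; split=> -[xy yx]; split.
- move=> i; have [q _ /(_ (lex1 _)) [j _ /IH ?]] := xy i p (lexx _); by exists j.
- move=> j; have [q _ /(_ (lex1 _)) [i _ /IH ?]] := yx j p (lexx _); by exists i.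
- move=> i q _; exists q => // _; have [j ?] := xy i; exists j; rewrite ?lex1 //; exact/IH.
- move=> j q _; exists q => // _; have [i ?] := yx j; exists i; rewrite ?lex1 //; exact/IH.
Qed.

Lemma forces_mem_check a b p : forces_mem (check a) (check b) p <-> vmem a b.
Proof.
case: b => Y y; split=> [ab|[j ayj]].
- by have [q _ [j _ /forces_eq_check ?]] := ab p (lexx _); exists j.
- by move=> q _; exists q => //; exists j; rewrite ?lex1 //; exact/forces_eq_check.
Qed.

Lemma filter_top g : @is_filter d P g -> g \top.
Proof. by move=> [[p gp] up _]; apply: up gp _; exact: lex1. Qed.

(** Every filter contains [\top], so no element of [a] is lost. *)
Lemma veq_eval_check g a b :
  @is_filter d P g -> veq (eval g (check a)) b <-> veq a b.
Proof.
move=> /filter_top gT; elim: a b => X x IH [Y y]; split=> -[xy yx]; split.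
- by move=> i; have [j /IH ?] := xy (exist _ i gT); exists j.
- by move=> j; have [[i gi] /IH ?] := yx j; exists i.
- by move=> [i gi] /=; have [j /IH ?] := xy i; exists j.
- by move=> j; have [i /IH ?] := yx j; exists (exist _ i gT).
Qed.

(** A maximal antichain among those lying below [D]. It is predense: a condition
below some member of [D] and incompatible with the antichain could be added to
it. *)
Lemma predense_refining_antichain D : predense D ->
  exists A : set P,
    [/\ antichain A, predense A & forall p, A p -> exists2 q, D q & p <= q].
Proof.
move=> preD.
pose refines (A : set P) := antichain A /\ forall p, A p -> exists2 q, D q & p <= q.
have [F sF totF|A [[anti AD] maxA]] := @Zorn_bigcup _ refines.
  split=> [p q [X FX Xp] [Y FY Yq]|p [X FX Xp]]; last by have [_] := sF X FX; apply.
  have [XY|YX] := totF X Y FX FY.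
  - by have [anti _] := sF Y FY; apply: anti => //; exact: XY.
  - by have [anti _] := sF X FX; apply: anti => //; exact: YX.
exists A; split=> // p; have [q Dq [r [rp rq]]] := preD p.
apply: contrapT => noA.
have nocomp a : A a -> ~ compatible r a.
  move=> Aa [s [sr sa]]; apply: noA; exists a => //.
  by exists s; split=> //; exact: le_trans sr rp.
apply: (maxA (r |` A)).
  split=> [a|/(_ r)]; first by right.
  by move=> /(_ (or_introl erefl)) Ar; apply: (nocomp r Ar); exists r.
split=> [a b [->|Aa] [->|Ab] ab|a [->|/AD//]].
- by [].
- exact: nocomp.
- by move=> [s [sa sb]]; apply: (nocomp a Aa); exists s.
- exact: anti.
- by exists q.
Qed.

Section NiceNames.
Context {kappa : cardinal}.
Implicit Types (A : kappa -> set P) (g : set P).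

(** By injectivity of [vN], only the antichain at [a] can put [a] into the
evaluation. *)
Lemma vmem_eval_nice g A a : is_filter g ->
  vmem (vN a) (eval g (nice_name_of A)) <-> exists2 c, A a c & g c.
Proof.
move=> fg; split.
  move=> [[[[b c] /= Ac] /= gc] /= /veq_sym /(veq_eval_check _ _ fg) /vN_inj ba].
  by exists c => //; rewrite -ba.
move=> [c Ac gc]; exists (exist _ (exist _ (a, c) Ac) gc) => /=.
by apply/veq_sym/(veq_eval_check _ _ fg)/veq_refl.
Qed.

Lemma eval_nice_full g A : is_filter g ->
  veq (eval g (nice_name_of A)) (vN_card kappa) <->
  forall a, exists2 c, A a c & g c.
Proof.
move=> fg; split=> [[_ full] a|full].
  by apply/vmem_eval_nice => //; have [i /veq_sym ?] := full a; exists i.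
split=> [[[[a c] /= Ac] /= gc]|a].
  by exists a; apply/(veq_eval_check _ _ fg)/veq_refl.
by have /(vmem_eval_nice _ _ fg) [i /veq_sym ?] := full a; exists i.
Qed.

Lemma forces_nice_full A p : (forall a, predense (A a)) ->
  forces_eq (nice_name_of A) (check (vN_card kappa)) p.
Proof.
move=> preA; split=> [[[a c] Ac] q _|a q _] /=.
  by exists q => // _; exists a; rewrite ?lex1 //; exact: forces_eq_refl.
have [c Ac [r [rq rc]]] := preA a q; exists r => // _.
by exists (exist _ (a, c) Ac) => //; exact: forces_eq_refl.
Qed.

Lemma forces_mem_nice A a p :
  forces_mem (check (vN a)) (nice_name_of A) p <->
  dense_below p [set q | exists2 c, A a c & q <= c].
Proof.
split=> H q qp; have [r rq] := H q qp.
- move=> [[[b c] /= Ac] /= rc /forces_eq_check /vN_inj ab].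
  by exists r => //; exists c => //; rewrite ab.
- move=> [c Ac rc]; exists r => //; exists (exist _ (a, c) Ac) => //.
  exact: forces_eq_refl.
Qed.

End NiceNames.

Lemma push0 T n (x : T) (v : 'I_n -> T) : push x v ord0 = x.
Proof. by rewrite /push unlift_none. Qed.

Lemma push_rel T U (R : T -> U -> Prop) n x y (v : 'I_n -> T) (w : 'I_n -> U) :
  R x y -> (forall i, R (v i) (w i)) -> forall i, R (push x v i) (push y w i).
Proof. by move=> Rxy Rvw i; rewrite /push; case: unlift. Qed.

(** * Forcing inside the structure *)

Section StructureForcing.
Context {kappa : cardinal} (A : kappa -> set P).

(** Forcing over the structure [(kappa, \in, sigma)], where [sigma] is the nice
name given by [A]: variables and quantifiers range over [kappa] itself instead
of over names, and the atomic facts about [kappa] are the true ones. *)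
Fixpoint sforces n (f : formula n) : ('I_n -> kappa) -> set P :=
  match f in formula n return ('I_n -> kappa) -> set P with
  | FEq _ i j => fun v p => v i = v j
  | FMem _ i j => fun v p => vmem (vN (v i)) (vN (v j))
  | FPred _ i => fun v p => dense_below p [set q | exists2 c, A (v i) c & q <= c]
  | FNot _ f => fun v p => forall q, q <= p -> ~ sforces f v q
  | FAnd _ f h => fun v p => sforces f v p /\ sforces h v p
  | FAll _ f => fun v p => forall x, sforces f (push x v) p
  end.

Lemma sforces_le n (f : formula n) v p q :
  q <= p -> sforces f v p -> sforces f v q.
Proof.
elim: f v p q => {n} [n i j|n i j|n i|n f IHf|n f IHf h IHh|n f IHf] v p q qp //=.
- exact: dense_below_le.
- by move=> nf r rq; apply: nf; exact: le_trans qp.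
- by move=> [/(IHf _ _ _ qp) ? /(IHh _ _ _ qp)].
- by move=> fx x; apply: IHf qp _.
Qed.

Lemma sforces_dense n (f : formula n) v p :
  dense_below p (sforces f v) -> sforces f v p.
Proof.
elim: f v p => {n} [n i j|n i j|n i|n f IHf|n f IHf h IHh|n f IHf] v p //= df.
- by have [] := df p (lexx _).
- by have [] := df p (lexx _).
- move=> q qp; have [r rq dr] := df q qp; have [s sr ?] := dr r (lexx _).
  by exists s => //; exact: le_trans rq.
- move=> q qp fq; have [r rq /(_ r (lexx _))] := df q qp.
  by apply; exact: sforces_le fq.
- by split; [apply: IHf|apply: IHh] => q /df [r rq [? ?]]; exists r.
- by move=> x; apply: IHf => q /df [r rq ?]; exists r.
Qed.

Lemma sforces_FNotP n (f : formula n) v p :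
  sforces f v p \/ exists2 q, q <= p & sforces (FNot f) v q.
Proof.
have [|none] := pselect (exists2 q, q <= p & sforces (FNot f) v q); [by right|left].
apply: sforces_dense => q qp; apply: contrapT => nf; apply: none; exists q => // r rq fr.
by apply: nf; exists r.
Qed.

(** The two forcing relations agree. The valuation [w] is only required to be
forced equal to [v], not to consist of check names: a quantifier on the left
ranges over arbitrary names, and a name forced into [kappa] is, below some
stronger condition, forced equal to the check name of some [x] of [kappa].
This generality builds the substitution of forced-equal names into the
induction. *)
Lemma forces_satisfies n (f : formula n) (w : 'I_n -> name P) v p :
  (forall i, forces_eq (w i) (check (vN (v i))) p) ->
  forces (satisfies (check (vN_card kappa)) (nice_name_of A) f) w p <->
  sforces f v p.
Proof.
elim: f w v p => {n} [n i j|n i j|n i|n f IHf|n f IHf h IHh|n f IHf] w v p wv /=.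
- split=> [wij|vij].
    apply: vN_inj; rewrite -(forces_eq_check _ _ p).
    by apply: forces_eq_trans (wv j); apply: forces_eq_trans wij; exact: forces_eq_sym.
  by apply: forces_eq_trans (wv i) _; rewrite vij; exact: forces_eq_sym.
- rewrite -(forces_mem_check _ _ p); split=> H.
    exact: forces_mem_eql (wv i) (forces_mem_eqr (wv j) H).
  apply: forces_mem_eql (forces_eq_sym (wv i)) _.
  exact: forces_mem_eqr (forces_eq_sym (wv j)) H.
- rewrite -[_ <-> _]/(forces_mem _ (nice_name_of A) p <-> dense_below p _).
  rewrite -forces_mem_nice; split; first exact: forces_mem_eql (wv i).
  exact: forces_mem_eql (forces_eq_sym (wv i)).
- have IH q : q <= p -> _ := fun qp => IHf w v q (fun i => forces_eq_le qp (wv i)).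
  by split=> nf q qp /(IH q qp); exact: nf.
- by have := IHf w v p wv; have := IHh w v p wv; tauto.
have IH q t x : q <= p -> forces_eq t (check (vN x)) q -> _ := fun qp tx =>
  IHf (push t w) (push x v) q (push_rel (R := fun s a => forces_eq s (check (vN a)) q)
    tx (fun i => forces_eq_le qp (wv i))).
split=> [all x|all t q qp].
  apply: sforces_dense => q qp; apply: contrapT => nof.
  apply: (all (check (vN x)) q qp); rewrite push0; split.
    by apply: (forces_mem_check (vN x) (vN_card kappa) q).2; exists x; exact: veq_refl.
  move=> r rq fr; apply: nof; exists r => //.
  by apply/(IH _ _ _ (le_trans rq qp) (forces_eq_refl _ _)).
rewrite push0 => -[tK nof]; have [r rq [x _ tx]] := tK q (lexx _).
apply: (nof r rq); apply/(IH _ _ _ (le_trans rq qp) tx).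
exact: sforces_le (le_trans rq qp) (all x).
Qed.

(** The truth lemma, for filters that need not be generic: a formula true in the
evaluated structure is forced by a member of [g], and a false one has its
negation forced. Only two steps of the induction ask anything of [g]. The
predicate must be decided, and this by a member of the antichain, since the
evaluation counts the members of the antichain in [g]; and a universal formula
all of whose instances are forced by members of [g] must be forced by one
member of [g]. *)
Lemma truth_lemma g : is_filter g ->
  (forall n (i : 'I_n) v, (exists2 c, A (v i) c & g c) \/
     exists2 p, g p & sforces (FNot (FPred i)) v p) ->
  (forall n (f : formula n.+1) v,
     (forall x, exists2 p, g p & sforces f (push x v) p) ->
     exists2 p, g p & sforces (FAll f) v p) ->
  forall phi : sentence,
    forced (satisfies (check (vN_card kappa)) (nice_name_of A) phi) ->
    models kappa (eval g (nice_name_of A)) phi.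
Proof.
move=> fg gPred gAll; have [gN0 _ gdir] := fg.
pose holds n : formula n -> ('I_n -> kappa) -> Prop :=
  sat (fun x y : kappa => vmem (vN x) (vN y))
      (fun x : kappa => vmem (vN x) (eval g (nice_name_of A))) (n := n).
have decided n (f : formula n) v :
    (holds n f v -> exists2 p, g p & sforces f v p) /\
    (~ holds n f v -> exists2 p, g p & sforces (FNot f) v p).
  elim: f v => {n} [n i j|n i j|n i|n f IHf|n f IHf h IHh|n f IHf] v /=.
  - by have [p gp] := gN0; split=> ?; exists p.
  - by have [p gp] := gN0; split=> ?; exists p.
  - have iA := vmem_eval_nice A (v i) fg; split=> [/iA [c Ac gc]|noc].
      by exists c => // q qc; exists q => //; exists c.
    by case: (gPred n i v) => // /iA /noc.
  - have [pos neg] := IHf v; split=> // /contrapT /pos [p gp fp].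
    by exists p => // q qp; apply; [exact: lexx|exact: sforces_le fp].
  - have [posf negf] := IHf v; have [posh negh] := IHh v; split.
      move=> [/posf [p gp fp] /posh [q gq hq]]; have [r gr [rp rq]] := gdir p q gp gq.
      by exists r => //; split; [exact: sforces_le fp|exact: sforces_le hq].
    move=> /not_andP [/negf|/negh] [p gp nf]; exists p => // q /nf nfq [? ?]; exact: nfq.
  - split; first by move=> all; apply: gAll => x; apply: (IHf _).1.
    move=> /existsNP [x /(IHf _).2 [p gp nf]]; exists p => // q /nf nfq all.
    exact: nfq (all x).
move=> phi phiT.
have {}phiT : sforces phi (@novars kappa) \top.
  by apply/(@forces_satisfies _ _ (@novars (name P))) => // -[].
apply: contrapT => /(decided _ _ _).2 [p gp /(_ p (lexx _))]; apply.
exact: sforces_le (lex1 p) phiT.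
Qed.

(** The dense sets that supply what [truth_lemma] asks of a filter, one for each
formula and valuation; they are trivial for the other connectives. *)
Definition settles n (f : formula n) : ('I_n -> kappa) -> set P :=
  match f in formula n return ('I_n -> kappa) -> set P with
  | FPred _ i => fun v => [set p | (exists2 c, A (v i) c & p <= c) \/
                                   sforces (FNot (FPred i)) v p]
  | FAll _ f => fun v => [set p | sforces (FAll f) v p \/
                                  exists x, sforces (FNot f) (push x v) p]
  | _ => fun=> setT
  end.

Lemma settles_le n (f : formula n) v p q :
  q <= p -> settles f v p -> settles f v q.
Proof.
case: n / f v => // n => [i v qp [[c Ac pc]|nf]|f v qp [all|[x nf]]].
- by left; exists c => //; exact: le_trans pc.
- by right; exact: (sforces_le (f := FNot _)) nf.
- by left; exact: (sforces_le (f := FAll _)) all.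
- by right; exists x; exact: (sforces_le (f := FNot _)) nf.
Qed.

Lemma settles_dense n (f : formula n) v p : exists2 q, q <= p & settles f v q.
Proof.
case: n / f v => [n i j v|n i j v|n i v|n f v|n f h v|n f v]; try by exists p.
- have [/(_ p (lexx _)) [q qp qA]|[q qp nf]] := sforces_FNotP (FPred i) v p.
    by exists q => //; left.
  by exists q => //; right.
- have [all|/existsNP [x nf]] := pselect (sforces (FAll f) v p).
    by exists p => //; left.
  have [//|[q qp nfq]] := sforces_FNotP f (push x v) p.
  by exists q => //; right; exists x.
Qed.

(** If [g] contained a condition refuting one instance of a universal formula,
it could not also force that instance. *)
Lemma generic_truth g : is_filter g ->
  (forall n (f : formula n) v, g `&` settles f v !=set0) ->
  forall phi : sentence,
    forced (satisfies (check (vN_card kappa)) (nice_name_of A) phi) ->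
    models kappa (eval g (nice_name_of A)) phi.
Proof.
move=> fg gen; have [_ up gdir] := fg; apply: truth_lemma => // [n i v|n f v fx].
  have [p [gp [[c Ac pc]|nf]]] := gen n (FPred i) v; [left|right; by exists p].
  by exists c => //; exact: up pc.
have [p [gp [all|[x nf]]]] := gen n (FAll f) v; first by exists p.
have [q gq fq] := fx x; have [r gr [rp rq]] := gdir p q gp gq.
by case: (nf r rp); exact: sforces_le fq.
Qed.

(** For finite [kappa] there are more formulas than elements of [kappa], but a
single condition decides the whole predicate, and the principal filter above it
suffices: whatever a member of that filter forces is forced by its least
element, which therefore forces a universal formula as soon as each instance is
forced. *)
Lemma finite_truth : finite_set [set: kappa] ->
  exists2 g : set P, is_filter g & forall phi : sentence,
    forced (satisfies (check (vN_card kappa)) (nice_name_of A) phi) ->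
    models kappa (eval g (nice_name_of A)) phi.
Proof.
move=> /finite_seqP [s sT].
have [p ps] : exists p, forall x, x \in s -> settles (FPred (ord0 : 'I_1)) (fun=> x) p.
  elim: s {sT} => [|x s [p ps]]; first by exists \top.
  have [q qp qx] := settles_dense (FPred (ord0 : 'I_1)) (fun=> x) p.
  exists q => y; rewrite inE => /predU1P [->//|/ps]; exact: settles_le qp.
have {}ps x : settles (FPred (ord0 : 'I_1)) (fun=> x) p.
  by apply: ps; have : [set: kappa] x by []; rewrite sT.
have fp : is_filter [set q | p <= q].
  split; [by exists p; exact: lexx|by move=> ? ? /le_trans; apply|].
  by move=> q r pq pr; exists p => //; exact: lexx.
exists [set q | p <= q] => //; apply: truth_lemma => // [n i v|n f v fx].
  by have [[c Ac pc]|nf] := ps (v i); [left; exists c|right; exists p => //=].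
exists p; first exact: lexx.
by move=> x; have [q pq] := fx x; exact: sforces_le.
Qed.

End StructureForcing.
End Forcing.

Theorem theorem1p3 (d : Order.disp_t) (P : tPOrderType d) (kappa : cardinal) :
  let kappa_check : name P := check (vN_card kappa) in
  let clause1 : Prop := FA P kappa in
  let clause2 : Prop :=
    forall sigma : name P, nice_name kappa sigma ->
      forced (SEq (inr sigma) (inr kappa_check)) ->
      exists2 g : set P, is_filter g & veq (eval g sigma) (vN_card kappa) in
  let clause3 : Prop :=
    forall sigma : name P, nice_name kappa sigma ->
      exists2 g : set P, is_filter g &
        forall phi : sentence,
          forced (satisfies kappa_check sigma phi) ->
          models kappa (eval g sigma) phi in
  (clause1 <-> clause2) /\ (clause2 <-> clause3).
Proof.
move=> kappa_check clause1 clause2 clause3.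
(* The nice name built from antichains below the [D a] is forced to be full, and
   a filter that makes it full meets every [D a]. *)
have c21 : clause2 -> clause1.
  move=> c2 D preD.
  have /choice [A AP] a := predense_refining_antichain (preD a).
  have [||g fg gA] := c2 (nice_name_of A).
  - by exists A => // a; case: (AP a).
  - by apply: forces_nice_full => a; case: (AP a).
  exists g => // a; have [_ up _] := fg.
  have [p Ap gp] := (eval_nice_full _ fg).1 gA a.
  have [_ _ /(_ p Ap) [q Dq pq]] := AP a.
  by exists q; split=> //; exact: up pq.
(* Being full is the sentence saying that the predicate holds everywhere. *)
have c32 : clause3 -> clause2.
  move=> c3 _ [A antiA ->] full.
  have [|g fg true_g] := c3 (nice_name_of A); first by exists A.
  exists g => //; apply/eval_nice_full => // a.
  have := true_g (FAll (FPred ord0)) _ a; rewrite push0 vmem_eval_nice //; apply.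
  move=> t q _ [tK /(_ q (lexx _))]; apply.
  apply: (forces_mem_eqr (t := kappa_check) _ tK).
  exact: forces_eq_le (lex1 q) (forces_eq_sym full).
have c13 : clause1 -> clause3.
  move=> fa _ [A _ ->].
  have [fin|inf] := pselect (finite_set [set: kappa]); first exact: finite_truth.
  have [c cinj] := infinite_instances_injective inf.
  have [|g fg gen] :=
    FA_injective (D := fun k => settles A (tagged k).1 (tagged k).2) cinj fa.
    move=> k p; have [q qp ?] := settles_dense A (tagged k).1 (tagged k).2 p.
    by exists q => //; exists q.
  by exists g => //; apply: generic_truth => // n f v; exact: (gen (existT _ n (f, v))).
split; split; tauto.
Qed.
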